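(* The pair of varieties $(\mathrm{RBCom},\mathrm{preCom})$, with the functor $\psi$ sending a commutative Rota–Baxter algebra $\langle U,\cdot,R\rangle$ of weight zero to the precommutative algebra $\langle U,\succ\rangle$, $x\succ y=R(x)y$, is not a PBW-pair.
   Context: All algebras are over a field $\Bbbk$ and are not assumed to have a unit; ''commutative algebra'' means commutative and associative algebra. A linear operator $R$ on an algebra $A$ is a Rota–Baxter operator of weight $0$ if $R(x)R(y)=R(R(x)y+xR(y))$ for all $x,y\in A$. $\mathrm{RBCom}$ is the variety of commutative algebras equipped with a Rota–Baxter operator of weight $0$. $\mathrm{preCom}$ is the variety of precommutative (Zinbiel) algebras: vector spaces with a bilinear product $\succ$ satisfying $(x_1\succ x_2+x_2\succ x_1)\succ x_3=x_1\succ(x_2\succ x_3)$. PBW-pairs. Let $\mathcal V,\mathcal W$ be varieties of algebras and $\psi:\mathcal V\to\mathcal W$ a functor that preserves the underlying vector space of an algebra but changes the operations on it. For $A\in\mathcal W$, the universal enveloping algebra $U(A)\in\mathcal V$ is the image of $A$ under the left adjoint functor of $\psi$. It carries the natural ascending filtration $U_1(A)\subseteq U_2(A)\subseteq\dots$, where $U_n(A)$ is the linear span of all values in $U(A)$ of monomials in the operations of $\mathcal V$ (here: the multiplication and $R$) involving at most $n$ occurrences of elements of the image of $A$ (applying $R$ does not change this number); $\mathrm{gr}\,U(A)$ is the associated graded algebra in $\mathcal V$. $\mathrm{Ab}\,A$ denotes the vector space $A$ with all multiplicative operations trivial (zero). The pair $(\mathcal V,\mathcal W)$ with the functor $\psi$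 is called a PBW-pair if $\mathrm{gr}\,U(A)\cong U(\mathrm{Ab}\,A)$ (isomorphism of algebras of $\mathcal V$) for every $A\in\mathcal W$. *)

(* Defs.v *)
(* Mathematical Components, with the classical axioms of mathcomp.classical *)
From HB Require Import structures.
From mathcomp Require Import all_boot all_order all_algebra.
From mathcomp Require Import boolp classical_sets.

Set Implicit Arguments.
Unset Strict Implicit.
Unset Printing Implicit Defensive.

Import GRing.Theory.
Local Open Scope ring_scope.
Local Open Scope classical_set_scope.

(* Linearity of [rbmul] in its first argument follows from commutativity. *)
HB.mixin Record Lmodule_isRBCom (k : fieldType) (U : Type)
    of GRing.Lmodule k U := {
  rbmul : U -> U -> U;
  rbop : U -> U;
  rbmul_is_linear : forall x : U, linear (rbmul x);
  rbmulC : commutative rbmul;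
  rbmulA : associative rbmul;
  rbop_is_linear : linear rbop;
  rota_baxter : forall x y : U,
    rbmul (rbop x) (rbop y) = rbop (rbmul (rbop x) y + rbmul x (rbop y))
}.

#[short(type="rbComType")]
HB.structure Definition RBCom (k : fieldType) :=
  {U of GRing.Lmodule k U & Lmodule_isRBCom k U}.

HB.mixin Record Lmodule_isPreCom (k : fieldType) (A : Type)
    of GRing.Lmodule k A := {
  zmul : A -> A -> A;
  zmul_is_linear_l : forall y : A, linear (zmul^~ y);
  zmul_is_linear_r : forall x : A, linear (zmul x);
  zmul_zinbiel : forall x1 x2 x3 : A,
    zmul (zmul x1 x2 + zmul x2 x1) x3 = zmul x1 (zmul x2 x3)
}.

#[short(type="preComType")]
HB.structure Definition PreCom (k : fieldType) :=
  {A of GRing.Lmodule k A & Lmodule_isPreCom k A}.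

Definition rb_hom (k : fieldType) (U V : rbComType k) (f : {linear U -> V}) :
    Prop :=
  (forall x y, f (rbmul x y) = rbmul (f x) (f y)) /\
  (forall x, f (rbop x) = rbop (f x)).

Definition precom_hom (k : fieldType) (A B : preComType k)
    (f : {linear A -> B}) : Prop :=
  forall x y, f (zmul x y) = zmul (f x) (f y).

Definition rb_isomorphic (k : fieldType) (U V : rbComType k) : Prop :=
  exists f : {linear U -> V}, rb_hom f /\ bijective f.

Section RBTheory.
Variables (k : fieldType) (U : rbComType k).
Implicit Types x y : U.

HB.instance Definition _ x :=
  GRing.isLinear.Build k U U *:%R (rbmul x) (rbmul_is_linear x).
HB.instance Definition _ :=
  GRing.isLinear.Build k U U *:%R (@rbop k U) rbop_is_linear.

Lemma rbmulDl x y z : rbmul (x + y) z = rbmul x z + rbmul y z.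
Proof. by rewrite !(rbmulC _ z) linearD. Qed.

Lemma rbmulZl c x y : rbmul (c *: x) y = c *: rbmul x y.
Proof. by rewrite !(rbmulC _ y) linearZ. Qed.

Lemma rbmul0l x : rbmul 0 x = 0.
Proof. by rewrite rbmulC linear0. Qed.

Lemma rbmul_suml (I : Type) (r : seq I) (P : pred I) (F : I -> U) y :
  rbmul (\sum_(i <- r | P i) F i) y = \sum_(i <- r | P i) rbmul (F i) y.
Proof. by rewrite rbmulC linear_sum; apply: eq_bigr => i _; rewrite rbmulC. Qed.

End RBTheory.

Definition psi (k : fieldType) (U : rbComType k) : Type := U.

Section Psi.
Variables (k : fieldType) (U : rbComType k).

HB.instance Definition _ := GRing.Lmodule.on (psi U).

Let psi_mul (x y : psi U) : psi U := rbmul (rbop (x : U)) (y : U).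

Fact psi_linear_l y : linear (psi_mul^~ y).
Proof. by move=> c x z; rewrite /psi_mul linearP rbmulDl rbmulZl. Qed.

Fact psi_linear_r x : linear (psi_mul x).
Proof. by move=> c y z; rewrite /psi_mul linearP. Qed.

Fact psi_zinbiel x1 x2 x3 :
  psi_mul (psi_mul x1 x2 + psi_mul x2 x1) x3 = psi_mul x1 (psi_mul x2 x3).
Proof.
by rewrite /psi_mul rbmulA rota_baxter (rbmulC x1 (rbop x2 : U)).
Qed.

HB.instance Definition _ := Lmodule_isPreCom.Build k (psi U)
  psi_linear_l psi_linear_r psi_zinbiel.

Lemma psi_mulE (x y : U) : zmul (x : psi U) (y : psi U) = rbmul (rbop x) y.
Proof. by []. Qed.

End Psi.

(* psi acts as the identity on morphisms. *)
Lemma psi_hom (k : fieldType) (U V : rbComType k) (f : {linear U -> V}) :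
  rb_hom f -> precom_hom (f : {linear psi U -> psi V}).
Proof. by move=> [fM fR] x y; rewrite !psi_mulE /= fM fR. Qed.

Definition Ab (k : fieldType) (A : preComType k) : Type := A.

Section AbInstance.
Variables (k : fieldType) (A : preComType k).

HB.instance Definition _ := GRing.Lmodule.on (Ab A).

Let ab_mul (_ _ : Ab A) : Ab A := 0.

Fact ab_linear_l y : linear (ab_mul^~ y).
Proof. by move=> c x z; rewrite /ab_mul scaler0 addr0. Qed.

Fact ab_linear_r x : linear (ab_mul x).
Proof. by move=> c y z; rewrite /ab_mul scaler0 addr0. Qed.

Fact ab_zinbiel x1 x2 x3 :
  ab_mul (ab_mul x1 x2 + ab_mul x2 x1) x3 = ab_mul x1 (ab_mul x2 x3).
Proof. by []. Qed.

HB.instance Definition _ := Lmodule_isPreCom.Build k (Ab A)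
  ab_linear_l ab_linear_r ab_zinbiel.

End AbInstance.

(* A left adjoint of psi, given by its universal arrows [env_unit]; its action
   on morphisms is determined by [env_universal].  Such an adjoint is unique up
   to isomorphism; one is constructed in [env_left_adjoint] below. *)
Record left_adjoint_of_psi (k : fieldType) := LeftAdjoint {
  env :> preComType k -> rbComType k;
  env_unit : forall A : preComType k, {linear A -> psi (env A)};
  env_unit_hom : forall A : preComType k, precom_hom (env_unit A);
  env_universal : forall (A : preComType k) (B : rbComType k)
      (f : {linear A -> psi B}), precom_hom f ->
    exists g : {linear env A -> B},
      [/\ rb_hom g,
          forall x : A, g (env_unit A x) = f x &
          forall h : {linear env A -> B}, rb_hom h ->
            (forall x : A, h (env_unit A x) = f x) -> h =1 g]
}.

Section Filtration.
Variables (k : fieldType) (B : rbComType k) (X : set B).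

(* [monomial_value n u] : u is the value in B of a monomial in the product and
   the Rota-Baxter operator with exactly n occurrences of elements of X. *)
Inductive monomial_value : nat -> B -> Prop :=
| MonVar x : X x -> monomial_value 1 x
| MonMul m n u v : monomial_value m u -> monomial_value n v ->
    monomial_value (m + n) (rbmul u v)
| MonOp n u : monomial_value n u -> monomial_value n (rbop u).

Definition lin_span (S : set B) : set B :=
  [set u | exists (m : nat) (c : 'I_m -> k) (x : 'I_m -> B),
    (forall i, S (x i)) /\ u = \sum_i c i *: x i].

Definition filtration (n : nat) : set B :=
  lin_span [set u | exists2 m, (m <= n)%N & monomial_value m u].

Lemma lin_span_gen S u : S u -> lin_span S u.
Proof.
move=> Su; exists 1%N, (fun=> 1), (fun=> u); split=> //.
by rewrite big_ord1 scale1r.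
Qed.

Lemma lin_span0 S : lin_span S 0.
Proof.
by exists 0%N, (fun=> 0), (fun=> 0); split=> [[]//|]; rewrite big_ord0.
Qed.

Lemma lin_spanZ S a u : lin_span S u -> lin_span S (a *: u).
Proof.
move=> [m [c [x [Sx ->]]]]; exists m, (fun i => a * c i), x; split=> //.
by rewrite scaler_sumr; apply: eq_bigr => i _; rewrite scalerA.
Qed.

Lemma lin_spanD S u v : lin_span S u -> lin_span S v -> lin_span S (u + v).
Proof.
move=> [m [c [x [Sx ->]]]] [n [d [y [Sy ->]]]]; exists (m + n)%N.
exists (fun i => match split i with inl j => c j | inr j => d j end).
exists (fun i => match split i with inl j => x j | inr j => y j end).
split=> [i|]; first by case: (split i).
rewrite big_split_ord /=; congr (_ + _); apply: eq_bigr => i _.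
  by rewrite (unsplitK (inl i : 'I_m + 'I_n)).
by rewrite (unsplitK (inr i : 'I_m + 'I_n)).
Qed.

Lemma lin_span_sum S (I : Type) (r : seq I) (P : pred I) (F : I -> B) :
  (forall i, P i -> lin_span S (F i)) -> lin_span S (\sum_(i <- r | P i) F i).
Proof.
by move=> SF; apply: big_ind => //; [exact: lin_span0 | exact: lin_spanD].
Qed.

Lemma filtrationN n u : filtration n u -> filtration n (- u).
Proof. by rewrite -scaleN1r; apply: lin_spanZ. Qed.

Lemma filtration_le m n u : (m <= n)%N -> filtration m u -> filtration n u.
Proof.
move=> le_mn [p [c [x [Sx ->]]]]; exists p, c, x; split=> // i.
by have [q le_qm xq] := Sx i; exists q => //; apply: leq_trans le_mn.
Qed.

Lemma filtrationM m n u v :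
  filtration m u -> filtration n v -> filtration (m + n) (rbmul u v).
Proof.
move=> [p [c [x [Sx ->]]]] [q [d [y [Sy ->]]]].
rewrite rbmul_suml; apply: lin_span_sum => i _.
rewrite rbmulZl; apply: lin_spanZ.
rewrite linear_sum; apply: lin_span_sum => j _.
rewrite linearZ; apply: lin_spanZ; apply: lin_span_gen.
have [m' lem xm] := Sx i; have [n' len yn] := Sy j.
by exists (m' + n')%N; [apply: leq_add | apply: MonMul].
Qed.

Lemma filtration_op n u : filtration n u -> filtration n (rbop u).
Proof.
move=> [p [c [x [Sx ->]]]]; rewrite linear_sum; apply: lin_span_sum => i _.
rewrite linearZ; apply: lin_spanZ; apply: lin_span_gen.
by have [m' lem xm] := Sx i; exists m' => //; apply: MonOp.
Qed.

Lemma monomial_value_gt0 n u : monomial_value n u -> (0 < n)%N.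
Proof. by elim=> // p q ? ? _ p0 _ q0; rewrite addn_gt0 p0. Qed.

Lemma filtration0E u : filtration 0 u -> u = 0.
Proof.
move=> [p [c [x [Sx ->]]]]; apply: big1 => i _.
have [m' lem xm] := Sx i; have := monomial_value_gt0 xm.
by rewrite ltnNge lem.
Qed.

End Filtration.

Record rb_presetoid (k : fieldType) := RBPresetoid {
  ps_sort : Type;
  ps_eqv : ps_sort -> ps_sort -> Prop;
  ps_zero : ps_sort;
  ps_add : ps_sort -> ps_sort -> ps_sort;
  ps_opp : ps_sort -> ps_sort;
  ps_scale : k -> ps_sort -> ps_sort;
  ps_mul : ps_sort -> ps_sort -> ps_sort;
  ps_op : ps_sort -> ps_sort
}.

(* The operations are compatible with [ps_eqv] and satisfy the axioms of a
   commutative Rota-Baxter algebra modulo it. *)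
Record rb_congruence (k : fieldType) (S : rb_presetoid k) : Prop := {
  ps_refl : forall x : ps_sort S, ps_eqv x x;
  ps_sym : forall x y : ps_sort S, ps_eqv x y -> ps_eqv y x;
  ps_trans : forall x y z : ps_sort S,
    ps_eqv x y -> ps_eqv y z -> ps_eqv x z;
  ps_cong_add : forall x x' y y' : ps_sort S, ps_eqv x x' -> ps_eqv y y' ->
    ps_eqv (ps_add x y) (ps_add x' y');
  ps_cong_opp : forall x x' : ps_sort S, ps_eqv x x' ->
    ps_eqv (ps_opp x) (ps_opp x');
  ps_cong_scale : forall c (x x' : ps_sort S), ps_eqv x x' ->
    ps_eqv (ps_scale c x) (ps_scale c x');
  ps_cong_mul : forall x x' y y' : ps_sort S, ps_eqv x x' -> ps_eqv y y' ->
    ps_eqv (ps_mul x y) (ps_mul x' y');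
  ps_cong_op : forall x x' : ps_sort S, ps_eqv x x' ->
    ps_eqv (ps_op x) (ps_op x');
  ps_addA : forall x y z : ps_sort S,
    ps_eqv (ps_add x (ps_add y z)) (ps_add (ps_add x y) z);
  ps_addC : forall x y : ps_sort S, ps_eqv (ps_add x y) (ps_add y x);
  ps_add0 : forall x : ps_sort S, ps_eqv (ps_add (ps_zero S) x) x;
  ps_addN : forall x : ps_sort S, ps_eqv (ps_add (ps_opp x) x) (ps_zero S);
  ps_scaleA : forall c d (x : ps_sort S),
    ps_eqv (ps_scale c (ps_scale d x)) (ps_scale (c * d) x);
  ps_scale1 : forall x : ps_sort S, ps_eqv (ps_scale 1 x) x;
  ps_scaleDr : forall c (x y : ps_sort S),
    ps_eqv (ps_scale c (ps_add x y)) (ps_add (ps_scale c x) (ps_scale c y));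
  ps_scaleDl : forall (x : ps_sort S) c d,
    ps_eqv (ps_scale (c + d) x) (ps_add (ps_scale c x) (ps_scale d x));
  ps_mulC : forall x y : ps_sort S, ps_eqv (ps_mul x y) (ps_mul y x);
  ps_mulA : forall x y z : ps_sort S,
    ps_eqv (ps_mul x (ps_mul y z)) (ps_mul (ps_mul x y) z);
  ps_mulP : forall c (x y z : ps_sort S),
    ps_eqv (ps_mul x (ps_add (ps_scale c y) z))
           (ps_add (ps_scale c (ps_mul x y)) (ps_mul x z));
  ps_opP : forall c (x y : ps_sort S),
    ps_eqv (ps_op (ps_add (ps_scale c x) y))
           (ps_add (ps_scale c (ps_op x)) (ps_op y));
  ps_rota_baxter : forall x y : ps_sort S,
    ps_eqv (ps_mul (ps_op x) (ps_op y))
           (ps_op (ps_add (ps_mul (ps_op x) y) (ps_mul x (ps_op y))))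
}.

Record rb_setoid (k : fieldType) := RBSetoid {
  rbs_pre :> rb_presetoid k;
  rbs_cong : rb_congruence rbs_pre
}.

(* The elements of the quotient are the equivalence classes. *)
Definition rbquot (k : fieldType) (S : rb_setoid k) : Type :=
  {C : set (ps_sort S) | exists x, C = @ps_eqv k S x}.

Lemma eq_exist_irr (T : Type) (P : T -> Prop) (p q : {x | P x}) :
  sval p = sval q -> p = q.
Proof.
case: p q => [x Px] [y Py] /= xy; move: Px Py; rewrite xy => Px Py.
by rewrite (Prop_irrelevance Px Py).
Qed.

Section Quotient.
Variables (k : fieldType) (S : rb_setoid k).
Notation T := (ps_sort S).
Notation Q := (rbquot S).
Let cS := rbs_cong S.

Definition rbpi (x : T) : Q :=
  exist (fun C => exists x, C = _) _ (ex_intro _ x erefl).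

Definition rbrepr (q : Q) : T := sval (cid (svalP q)).

Lemma rbpiP x y : rbpi x = rbpi y <-> ps_eqv x y.
Proof.
split=> [[/(congr1 (fun C => C y)) /= ->]|xy]; first exact: ps_refl.
apply: eq_exist_irr; rewrite predeqE => z.
by split; apply: (ps_trans cS) => //; apply: (ps_sym cS).
Qed.

Lemma rbreprK q : rbpi (rbrepr q) = q.
Proof.
by apply: eq_exist_irr; rewrite /= /rbrepr; case: cid.
Qed.

Lemma rbrepr_pi x : ps_eqv (rbrepr (rbpi x)) x.
Proof. by apply/rbpiP; rewrite rbreprK. Qed.

Lemma rbquotW (P : Q -> Prop) : (forall x, P (rbpi x)) -> forall q, P q.
Proof. by move=> Ppi q; rewrite -(rbreprK q). Qed.

Definition rbq_add (p q : Q) : Q := rbpi (ps_add (rbrepr p) (rbrepr q)).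
Definition rbq_opp (p : Q) : Q := rbpi (ps_opp (rbrepr p)).
Definition rbq_scale (c : k) (p : Q) : Q := rbpi (ps_scale c (rbrepr p)).
Definition rbq_mul (p q : Q) : Q := rbpi (ps_mul (rbrepr p) (rbrepr q)).
Definition rbq_op (p : Q) : Q := rbpi (ps_op (rbrepr p)).

Lemma rbq_addE x y : rbq_add (rbpi x) (rbpi y) = rbpi (ps_add x y).
Proof. by apply/rbpiP; apply: (ps_cong_add cS); apply: rbrepr_pi. Qed.
Lemma rbq_oppE x : rbq_opp (rbpi x) = rbpi (ps_opp x).
Proof. by apply/rbpiP; apply: (ps_cong_opp cS); apply: rbrepr_pi. Qed.
Lemma rbq_scaleE c x : rbq_scale c (rbpi x) = rbpi (ps_scale c x).
Proof. by apply/rbpiP; apply: (ps_cong_scale cS); apply: rbrepr_pi. Qed.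
Lemma rbq_mulE x y : rbq_mul (rbpi x) (rbpi y) = rbpi (ps_mul x y).
Proof. by apply/rbpiP; apply: (ps_cong_mul cS); apply: rbrepr_pi. Qed.
Lemma rbq_opE x : rbq_op (rbpi x) = rbpi (ps_op x).
Proof. by apply/rbpiP; apply: (ps_cong_op cS); apply: rbrepr_pi. Qed.

Let rbqE := (rbq_addE, rbq_oppE, rbq_scaleE, rbq_mulE, rbq_opE).

HB.instance Definition _ := gen_eqMixin Q.
HB.instance Definition _ := gen_choiceMixin Q.

Fact rbq_addA : associative rbq_add.
Proof.
elim/rbquotW=> x; elim/rbquotW=> y; elim/rbquotW=> z.
by rewrite !rbqE; apply/rbpiP; apply: ps_addA.
Qed.
Fact rbq_addC : commutative rbq_add.
Proof.
elim/rbquotW=> x; elim/rbquotW=> y.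
by rewrite !rbqE; apply/rbpiP; apply: ps_addC.
Qed.
Fact rbq_add0 : left_id (rbpi (ps_zero S)) rbq_add.
Proof. by elim/rbquotW=> x; rewrite !rbqE; apply/rbpiP; apply: ps_add0. Qed.
Fact rbq_addN : left_inverse (rbpi (ps_zero S)) rbq_opp rbq_add.
Proof. by elim/rbquotW=> x; rewrite !rbqE; apply/rbpiP; apply: ps_addN. Qed.

HB.instance Definition _ :=
  GRing.isZmodule.Build Q rbq_addA rbq_addC rbq_add0 rbq_addN.

Fact rbq_scaleA c d (v : Q) :
  rbq_scale c (rbq_scale d v) = rbq_scale (c * d) v.
Proof.
by elim/rbquotW: v => x; rewrite !rbqE; apply/rbpiP; apply: ps_scaleA.
Qed.
Fact rbq_scale1 : left_id 1 rbq_scale.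
Proof. by elim/rbquotW=> x; rewrite !rbqE; apply/rbpiP; apply: ps_scale1. Qed.
Fact rbq_scaleDr : right_distributive rbq_scale +%R.
Proof.
move=> c; elim/rbquotW=> x; elim/rbquotW=> y.
by rewrite /+%R /= !rbqE; apply/rbpiP; apply: ps_scaleDr.
Qed.
Fact rbq_scaleDl (v : Q) : {morph rbq_scale^~ v : c d / c + d}.
Proof.
elim/rbquotW: v => x c d.
by rewrite [in RHS]/+%R /= !rbqE; apply/rbpiP; apply: ps_scaleDl.
Qed.

HB.instance Definition _ := GRing.Zmodule_isLmodule.Build k Q
  rbq_scaleA rbq_scale1 rbq_scaleDr rbq_scaleDl.

Lemma rbpiD x y : rbpi (ps_add x y) = rbpi x + rbpi y.
Proof. by rewrite -rbq_addE. Qed.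
Lemma rbpiZ c x : rbpi (ps_scale c x) = c *: rbpi x.
Proof. by rewrite -rbq_scaleE. Qed.
Lemma rbpi0 : rbpi (ps_zero S) = 0. Proof. by []. Qed.
Lemma rbpiN x : rbpi (ps_opp x) = - rbpi x.
Proof. by rewrite -rbq_oppE. Qed.

Fact rbq_mul_linear (p : Q) : linear (rbq_mul p).
Proof.
elim/rbquotW: p => x c; elim/rbquotW=> y; elim/rbquotW=> z.
rewrite -rbpiZ -rbpiD !rbqE -rbpiZ -rbpiD; apply/rbpiP; exact: ps_mulP.
Qed.
Fact rbq_mulC : commutative rbq_mul.
Proof.
elim/rbquotW=> x; elim/rbquotW=> y.
by rewrite !rbqE; apply/rbpiP; apply: ps_mulC.
Qed.
Fact rbq_mulA : associative rbq_mul.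
Proof.
elim/rbquotW=> x; elim/rbquotW=> y; elim/rbquotW=> z.
by rewrite !rbqE; apply/rbpiP; apply: ps_mulA.
Qed.
Fact rbq_op_linear : linear rbq_op.
Proof.
move=> c; elim/rbquotW=> y; elim/rbquotW=> z.
rewrite -rbpiZ -rbpiD !rbqE -rbpiZ -rbpiD; apply/rbpiP; exact: ps_opP.
Qed.
Fact rbq_rota_baxter (p q : Q) :
  rbq_mul (rbq_op p) (rbq_op q) =
  rbq_op (rbq_mul (rbq_op p) q + rbq_mul p (rbq_op q)).
Proof.
elim/rbquotW: p => x; elim/rbquotW: q => y.
rewrite (rbq_opE x) (rbq_opE y) !rbq_mulE -rbpiD rbq_opE.
by apply/rbpiP; apply: ps_rota_baxter.
Qed.

HB.instance Definition _ := Lmodule_isRBCom.Build k Q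
  rbq_mul_linear rbq_mulC rbq_mulA rbq_op_linear rbq_rota_baxter.

Lemma rbpiM x y : rbpi (ps_mul x y) = rbmul (rbpi x) (rbpi y).
Proof. by rewrite -rbq_mulE. Qed.
Lemma rbpiR x : rbpi (ps_op x) = rbop (rbpi x).
Proof. by rewrite -rbq_opE. Qed.

End Quotient.

(* gr = (+)_(n >= 1) U_n / U_(n-1) is presented as the quotient of the direct
   sum (+)_n U_n by (+)_n U_(n-1), where U_n is [filtration X n].  An element
   of (+)_n U_n is a finitely supported sequence with n-th term in U_n, the
   product is the convolution, and the operator acts termwise.  No monomial
   has zero occurrences of generators, so U_0 = 0 ([filtration0E]) and the
   component of degree 0 vanishes. *)
Record filtered_seq (k : fieldType) (B : rbComType k) (X : set B) :=
  FilteredSeq {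
    fs_val :> nat -> B;
    fs_in : forall n, filtration X n (fs_val n);
    fs_fin : exists N, forall n, (N <= n)%N -> fs_val n = 0
  }.

Section Graded.
Variables (k : fieldType) (B : rbComType k) (X : set B).
Notation F := (filtered_seq X).
Implicit Types (f g h : F) (n : nat).

Definition fs_eqv f g : Prop := forall n, filtration X n.-1 (f n - g n).

Program Definition fs_zero : F := @FilteredSeq k B X (fun=> 0) _ _.
Next Obligation. exact: lin_span0. Qed.
Next Obligation. by exists 0%N. Qed.

Program Definition fs_add f g : F :=
  @FilteredSeq k B X (fun n => f n + g n) _ _.
Next Obligation. by apply: lin_spanD; apply: fs_in. Qed.
Next Obligation.
have [M fM] := fs_fin f; have [N gN] := fs_fin g; exists (maxn M N) => n.
by rewrite geq_max => /andP[/fM-> /gN->]; rewrite addr0.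
Qed.

Program Definition fs_opp f : F := @FilteredSeq k B X (fun n => - f n) _ _.
Next Obligation. by apply: filtrationN; apply: fs_in. Qed.
Next Obligation.
by have [M fM] := fs_fin f; exists M => n /fM->; rewrite oppr0.
Qed.

Program Definition fs_scale (c : k) f : F :=
  @FilteredSeq k B X (fun n => c *: f n) _ _.
Next Obligation. by apply: lin_spanZ; apply: fs_in. Qed.
Next Obligation.
by have [M fM] := fs_fin f; exists M => n /fM->; rewrite scaler0.
Qed.

Program Definition fs_mul f g : F :=
  @FilteredSeq k B X
    (fun n => \sum_(i < n.+1) rbmul (f i) (g (n - i)%N)) _ _.
Next Obligation.
apply: lin_span_sum => i _.
rewrite -{1}(subnKC (ltn_ord i : (i <= n)%N)).
by apply: filtrationM; apply: fs_in.
Qed.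
Next Obligation.
have [M fM] := fs_fin f; have [N gN] := fs_fin g; exists (M + N)%N => n leMNn.
apply: big1 => i _; have [/fM->|ltiM] := leqP M i; first by rewrite rbmul0l.
rewrite gN ?linear0// leq_subRL; last exact: (ltn_ord i).
by apply: leq_trans leMNn; rewrite leq_add2r ltnW.
Qed.

Program Definition fs_op f : F := @FilteredSeq k B X (fun n => rbop (f n)) _ _.
Next Obligation. by apply: filtration_op; apply: fs_in. Qed.
Next Obligation.
by have [M fM] := fs_fin f; exists M => n /fM->; rewrite linear0.
Qed.

Definition gr_presetoid : rb_presetoid k :=
  RBPresetoid fs_eqv fs_zero fs_add fs_opp fs_scale fs_mul fs_op.

Lemma fs_eqvW f g : f =1 g -> fs_eqv f g.
Proof. by move=> fg n; rewrite fg subrr; apply: lin_span0. Qed.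

Lemma fs_eqv_trans f g h : fs_eqv f g -> fs_eqv g h -> fs_eqv f h.
Proof.
move=> fg gh n; rewrite -[f n](subrK (g n)) -addrA.
exact: (lin_spanD (fg n) (gh n)).
Qed.

Lemma fs_mulC f g : fs_mul f g =1 fs_mul g f.
Proof.
move=> n /=; rewrite (reindex_inj rev_ord_inj) /=; apply: eq_bigr => i _.
by rewrite subSS subKn 1?rbmulC// -ltnS.
Qed.

Lemma fs_mulA f g h : fs_mul f (fs_mul g h) =1 fs_mul (fs_mul f g) h.
Proof.
move=> n; rewrite [RHS]fs_mulC /=.
pose c (i j : nat) := rbmul (f i) (rbmul (h j) (g (n - i - j)%N)).
transitivity (\sum_(i < n.+1) \sum_(j < n.+1 | (j <= n - i)%N) c i j).
  apply: eq_bigr => i _; rewrite [X in rbmul _ X](fs_mulC g h) /= linear_sum /=.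
  by rewrite (big_ord_narrow_leq (leq_subr _ _)).
rewrite (exchange_big_dep predT)//=; apply: eq_bigr => j _.
transitivity (\sum_(i < n.+1 | (i <= n - j)%N) c i j).
  by apply: eq_bigl => i; rewrite !leq_subRL ?leq_ord// addnC.
rewrite (big_ord_narrow_leq (leq_subr _ _)) linear_sum /=.
apply: eq_bigr => i _.
by rewrite /c -!subnDA (addnC i) !rbmulA (rbmulC (f i)).
Qed.

Lemma fs_cong_mull f f' g : fs_eqv f f' -> fs_eqv (fs_mul f g) (fs_mul f' g).
Proof.
move=> ff' n /=; rewrite -sumrB; apply: lin_span_sum => i _.
rewrite !(rbmulC _ (g _)) -linearB.
have := ff' i; have lein : (i <= n)%N by rewrite -ltnS.
case: (posnP i) => [->|i0].
  by move/filtration0E => ->; rewrite linear0; apply: lin_span0.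
move=> /(filtrationM (fs_in g (n - i))); apply: filtration_le.
by rewrite -subn1 addnBA// subnK// subn1.
Qed.

Lemma gr_congruence : rb_congruence gr_presetoid.
Proof.
split=> /=.
- by move=> x; apply: fs_eqvW.
- by move=> x y xy n; rewrite -opprB; exact: (filtrationN (xy n)).
- exact: fs_eqv_trans.
- move=> x x' y y' xx' yy' n /=.
  by rewrite opprD addrACA; exact: (lin_spanD (xx' n) (yy' n)).
- by move=> x x' xx' n /=; rewrite -opprD; exact: (filtrationN (xx' n)).
- by move=> c x x' xx' n /=; rewrite -scalerBr; exact: (lin_spanZ c (xx' n)).
- move=> x x' y y' xx' yy'; apply: (@fs_eqv_trans _ (fs_mul x' y)).
    exact: fs_cong_mull.
  apply: (@fs_eqv_trans _ (fs_mul y x')); first exact/fs_eqvW/fs_mulC.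
  apply: (@fs_eqv_trans _ (fs_mul y' x')); last exact/fs_eqvW/fs_mulC.
  exact: fs_cong_mull.
- by move=> x x' xx' n /=; rewrite -linearB; exact: (filtration_op (xx' n)).
- by move=> x y z; apply: fs_eqvW => n /=; rewrite addrA.
- by move=> x y; apply: fs_eqvW => n /=; rewrite addrC.
- by move=> x; apply: fs_eqvW => n /=; rewrite add0r.
- by move=> x; apply: fs_eqvW => n /=; rewrite addNr.
- by move=> c d x; apply: fs_eqvW => n /=; rewrite scalerA.
- by move=> x; apply: fs_eqvW => n /=; rewrite scale1r.
- by move=> c x y; apply: fs_eqvW => n /=; rewrite scalerDr.
- by move=> x c d; apply: fs_eqvW => n /=; rewrite scalerDl.
- by move=> x y; apply: fs_eqvW; apply: fs_mulC.
- by move=> x y z; apply: fs_eqvW; apply: fs_mulA.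
- move=> c x y z; apply: fs_eqvW => n /=.
  by rewrite scaler_sumr -big_split; apply: eq_bigr => i _; rewrite linearP.
- by move=> c x y; apply: fs_eqvW => n /=; rewrite linearP.
- move=> x y; apply: fs_eqvW => n /=.
  by rewrite -big_split linear_sum; apply: eq_bigr => i _; rewrite rota_baxter.
Qed.

Definition gr : rbComType k := rbquot (RBSetoid gr_congruence).

End Graded.

Definition PBW_pair (k : fieldType) (U : left_adjoint_of_psi k) : Prop :=
  forall A : preComType k,
    rb_isomorphic (gr (range (env_unit U A : A -> U A))) (U (Ab A)).

(* The left adjoint: formal terms over A modulo the identities of RBCom, the
   linear relations of A and the relations [zmul a b] = R(a) b. *)
Inductive env_term (k : fieldType) (A : Type) : Type :=
| TVar (x : A)
| TZero
| TAdd (s t : env_term k A)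
| TOpp (t : env_term k A)
| TScale (c : k) (t : env_term k A)
| TMul (s t : env_term k A)
| TOp (t : env_term k A).

Arguments TVar {k A} x.
Arguments TZero {k A}.

Section Envelope.
Variables (k : fieldType) (A : preComType k).
Notation T := (env_term k A).

Inductive env_eqv : T -> T -> Prop :=
| ERefl x : env_eqv x x
| ESym x y : env_eqv x y -> env_eqv y x
| ETrans x y z : env_eqv x y -> env_eqv y z -> env_eqv x z
| ECAdd x x' y y' : env_eqv x x' -> env_eqv y y' ->
    env_eqv (TAdd x y) (TAdd x' y')
| ECOpp x x' : env_eqv x x' -> env_eqv (TOpp x) (TOpp x')
| ECScale c x x' : env_eqv x x' -> env_eqv (TScale c x) (TScale c x')
| ECMul x x' y y' : env_eqv x x' -> env_eqv y y' ->
    env_eqv (TMul x y) (TMul x' y')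
| ECOp x x' : env_eqv x x' -> env_eqv (TOp x) (TOp x')
| EAddA x y z : env_eqv (TAdd x (TAdd y z)) (TAdd (TAdd x y) z)
| EAddC x y : env_eqv (TAdd x y) (TAdd y x)
| EAdd0 x : env_eqv (TAdd TZero x) x
| EAddN x : env_eqv (TAdd (TOpp x) x) TZero
| EScaleA c d x : env_eqv (TScale c (TScale d x)) (TScale (c * d) x)
| EScale1 x : env_eqv (TScale 1 x) x
| EScaleDr c x y :
    env_eqv (TScale c (TAdd x y)) (TAdd (TScale c x) (TScale c y))
| EScaleDl x c d :
    env_eqv (TScale (c + d) x) (TAdd (TScale c x) (TScale d x))
| EMulC x y : env_eqv (TMul x y) (TMul y x)
| EMulA x y z : env_eqv (TMul x (TMul y z)) (TMul (TMul x y) z)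
| EMulP c x y z : env_eqv (TMul x (TAdd (TScale c y) z))
    (TAdd (TScale c (TMul x y)) (TMul x z))
| EOpP c x y : env_eqv (TOp (TAdd (TScale c x) y))
    (TAdd (TScale c (TOp x)) (TOp y))
| ERotaBaxter x y : env_eqv (TMul (TOp x) (TOp y))
    (TOp (TAdd (TMul (TOp x) y) (TMul x (TOp y))))
| EVarP c (a b : A) :
    env_eqv (TVar (c *: a + b)) (TAdd (TScale c (TVar a)) (TVar b))
| EVarM (a b : A) : env_eqv (TVar (zmul a b)) (TMul (TOp (TVar a)) (TVar b)).

Definition env_presetoid : rb_presetoid k :=
  RBPresetoid env_eqv TZero (@TAdd k A) (@TOpp k A) (@TScale k A) (@TMul k A)
    (@TOp k A).

Lemma env_congruence : rb_congruence env_presetoid.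
Proof.
split; [ exact: ERefl | exact: ESym | exact: ETrans | exact: ECAdd
  | exact: ECOpp | exact: ECScale | exact: ECMul | exact: ECOp
  | exact: EAddA | exact: EAddC | exact: EAdd0 | exact: EAddN
  | exact: EScaleA | exact: EScale1 | exact: EScaleDr | exact: EScaleDl
  | exact: EMulC | exact: EMulA | exact: EMulP | exact: EOpP
  | exact: ERotaBaxter ].
Qed.

Definition env_setoid : rb_setoid k := RBSetoid env_congruence.

Definition envelope : rbComType k := rbquot env_setoid.

Definition env_inj (a : A) : psi envelope :=
  rbpi (TVar a : ps_sort env_setoid).

Fact env_inj_is_linear : linear env_inj.
Proof.
by move=> c a b; rewrite /env_inj -rbpiZ -rbpiD; apply/rbpiP; apply: EVarP.
Qed.

HB.instance Definition _ :=
  GRing.isLinear.Build k A (psi envelope) *:%R env_inj env_inj_is_linear.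

Fact env_inj_hom : precom_hom env_inj.
Proof.
by move=> a b; rewrite psi_mulE -rbpiR -rbpiM; apply/rbpiP; apply: EVarM.
Qed.

Section Universal.
Variables (B : rbComType k) (f : {linear A -> psi B}) (fM : precom_hom f).

Fixpoint env_eval (t : T) : B :=
  match t with
  | TVar x => f x
  | TZero => 0
  | TAdd s t => env_eval s + env_eval t
  | TOpp t => - env_eval t
  | TScale c t => c *: env_eval t
  | TMul s t => rbmul (env_eval s) (env_eval t)
  | TOp t => rbop (env_eval t)
  end.

Lemma env_eval_eqv s t : env_eqv s t -> env_eval s = env_eval t.
Proof.
elim=> //=; try congruence.
- by move=> *; rewrite addrA.
- by move=> *; rewrite addrC.
- by move=> *; rewrite add0r.
- by move=> *; rewrite addNr.
- by move=> *; rewrite scalerA.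
- by move=> *; rewrite scale1r.
- by move=> *; rewrite scalerDr.
- by move=> *; rewrite scalerDl.
- by move=> *; rewrite rbmulC.
- by move=> *; rewrite rbmulA.
- by move=> *; rewrite linearP.
- by move=> *; rewrite linearP.
- by move=> *; rewrite rota_baxter.
- by move=> *; rewrite linearP.
Qed.

Definition env_lift (q : envelope) : B := env_eval (rbrepr q).

Lemma env_lift_pi t :
  env_lift (rbpi (t : ps_sort env_setoid)) = env_eval t.
Proof. by apply: env_eval_eqv; apply: (rbrepr_pi (S := env_setoid)). Qed.

Fact env_lift_is_linear : linear env_lift.
Proof.
move=> c; elim/rbquotW=> x; elim/rbquotW=> y.
by rewrite -rbpiZ -rbpiD !env_lift_pi.
Qed.

Definition env_lift_linear : {linear envelope -> B} := HB.pack env_lift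
  (GRing.isLinear.Build k envelope B *:%R env_lift env_lift_is_linear).

Lemma env_lift_hom : rb_hom env_lift_linear.
Proof.
split.
  by elim/rbquotW=> x; elim/rbquotW=> y; rewrite -rbpiM /= !env_lift_pi.
by elim/rbquotW=> x; rewrite -rbpiR /= !env_lift_pi.
Qed.

Lemma env_lift_unique (h : {linear envelope -> B}) :
  rb_hom h -> (forall x : A, h (env_inj x) = f x) -> h =1 env_lift.
Proof.
move=> [hM hR] hf; elim/rbquotW=> t; rewrite env_lift_pi.
elim: t => [x||s IHs t IHt|t IHt|c t IHt|s IHs t IHt|t IHt].
- exact: hf.
- by rewrite (rbpi0 env_setoid) linear0.
- by rewrite (rbpiD (S := env_setoid) s t) linearD IHs IHt.
- by rewrite (rbpiN (S := env_setoid) t) linearN IHt.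
- by rewrite (rbpiZ (S := env_setoid) c t) linearZ IHt.
- by rewrite (rbpiM (S := env_setoid) s t) hM IHs IHt.
- by rewrite (rbpiR (S := env_setoid) t) hR IHt.
Qed.

End Universal.

Lemma env_inj_universal (B : rbComType k) (f : {linear A -> psi B}) :
  precom_hom f ->
  exists g : {linear envelope -> B},
    [/\ rb_hom g,
        forall x : A, g (env_inj x) = f x &
        forall h : {linear envelope -> B}, rb_hom h ->
          (forall x : A, h (env_inj x) = f x) -> h =1 g].
Proof.
move=> fM; exists (env_lift_linear fM); split; first exact: env_lift_hom.
- by move=> x /=; rewrite env_lift_pi.
- exact: env_lift_unique.
Qed.

End Envelope.

Definition env_left_adjoint (k : fieldType) : left_adjoint_of_psi k :=
  @LeftAdjoint k (@envelope k) (fun A => @env_inj k A) (@env_inj_hom k)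
    (@env_inj_universal k).

(* Main.v *)
(** Let A be the precommutative algebra with basis a, b whose only nonzero
    product of basis elements is a ≻ a = b.  In U(A) one has
    b b = (R(a) a) b = (R(a) b) a = (a ≻ b) a = 0, so b b = 0 in gr U(A).
    Let N = x k[x] / (x^3), with R = 0.  For a morphism gr U(A) -> N, the
    x-coordinate kills products and values of R because it does so in N, and it
    kills b because an element of N of square zero lies in (x^2).  As gr U(A) is
    generated by a and b, all these x-coordinates are determined by their value
    at a, hence are pairwise proportional.  On U(Ab A), however, every linear
    map Ab A -> N extends to a morphism, so two linearly independent
    x-coordinates exist. *)
Require Import Defs.
From HB Require Import structures.
From mathcomp Require Import all_boot all_order all_algebra.
From mathcomp Require Import boolp classical_sets.

Set Implicit Arguments.
Unset Strict Implicit.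
Unset Printing Implicit Defensive.

Import GRing.Theory.
Local Open Scope ring_scope.
Local Open Scope classical_set_scope.

(** * Classes of homogeneous elements in the graded algebra *)

Section Symbol.
Variables (k : fieldType) (B : rbComType k) (X : set B).
Implicit Types (n : nat) (u v : B).

Program Definition homog n u (Fu : filtration X n u) : filtered_seq X :=
  @FilteredSeq k B X (fun i => if i == n then u else 0) _ _.
Next Obligation. by case: eqP => [->|_] //; apply: lin_span0. Qed.
Next Obligation. by exists n.+1 => i; case: eqP => // ->; rewrite ltnn. Qed.

Definition gr_pi (f : filtered_seq X) : gr X :=
  rbpi (f : ps_sort (RBSetoid (gr_congruence X))).

Definition symbol n u (Fu : filtration X n u) : gr X := gr_pi (homog Fu).

Lemma gr_piP (f g : filtered_seq X) : gr_pi f = gr_pi g <-> fs_eqv f g.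
Proof. exact: rbpiP. Qed.

Lemma gr_pi_eq (f g : filtered_seq X) : f =1 g -> gr_pi f = gr_pi g.
Proof. by move=> fg; apply/gr_piP/fs_eqvW. Qed.

(** A symbol carries a membership proof; this lets one proof be exchanged for another, built to suit
    a given expression of the element. *)
Lemma symbol_eq n u v (Fu : filtration X n u) (Fv : filtration X n v) :
  u = v -> symbol Fu = symbol Fv.
Proof. by move=> uv; apply: gr_pi_eq => i /=; rewrite uv. Qed.

Lemma symbol_low m n u (Fu : filtration X n u) :
  (m < n)%N -> filtration X m u -> symbol Fu = 0.
Proof.
move=> ltmn Fmu; rewrite -(rbpi0 (RBSetoid (gr_congruence X))).
apply/gr_piP => i /=; rewrite subr0; case: eqP => [->|_]; last exact: lin_span0.
by apply: filtration_le Fmu; rewrite -ltnS (ltn_predK ltmn).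
Qed.

Lemma symbol0 n (F0 : filtration X n 0) : symbol F0 = 0.
Proof.
rewrite -(rbpi0 (RBSetoid (gr_congruence X))).
by apply: gr_pi_eq => i /=; case: ifP.
Qed.

Lemma symbolD n u v (Fu : filtration X n u) (Fv : filtration X n v) :
  symbol (lin_spanD Fu Fv) = symbol Fu + symbol Fv.
Proof.
rewrite -[RHS]rbpiD; apply: gr_pi_eq => i /=.
by case: ifP => // _; rewrite addr0.
Qed.

Lemma symbolZ n c u (Fu : filtration X n u) :
  symbol (lin_spanZ c Fu) = c *: symbol Fu.
Proof.
rewrite -[RHS]rbpiZ; apply: gr_pi_eq => i /=.
by case: ifP => // _; rewrite scaler0.
Qed.

Lemma symbolM m n u v (Fu : filtration X m u) (Fv : filtration X n v) :
  symbol (filtrationM Fu Fv) = rbmul (symbol Fu) (symbol Fv).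
Proof.
rewrite -[RHS]rbpiM; apply: gr_pi_eq => i /=.
have [->|ne] := eqVneq i (m + n)%N.
  have ltm : (m < (m + n).+1)%N by rewrite ltnS leq_addr.
  (* In degree m + n only the index m contributes to the convolution. *)
  rewrite (bigD1 (Ordinal ltm)) //= eqxx addKn eqxx big1 ?addr0 // => j.
  by rewrite -val_eqE /= => /negPf ->; rewrite rbmul0l.
rewrite big1 // => j _; case: eqP => [jm|_]; last by rewrite rbmul0l.
case: eqP => [ijn|_]; last by rewrite linear0.
by case/eqP: ne; rewrite -jm -ijn subnKC // -ltnS.
Qed.

Lemma symbolR n u (Fu : filtration X n u) :
  symbol (filtration_op Fu) = rbop (symbol Fu).
Proof.
rewrite -[RHS]rbpiR; apply: gr_pi_eq => i /=.
by case: ifP => // _; rewrite linear0.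
Qed.

(** * Generation of the graded algebra in degree 1 *)

Section Generation.
Variables (W : lmodType k) (g : {linear gr X -> W}).
Hypothesis gX : forall x (Fx : filtration X 1 x), X x -> g (symbol Fx) = 0.
Hypothesis gM : forall p q, g (rbmul p q) = 0.
Hypothesis gR : forall p, g (rbop p) = 0.

(** The outermost operation decides, so no induction on the monomial is needed. *)
Lemma linear_eq0_monomial n u (Fu : filtration X n u) :
  monomial_value X n u -> g (symbol Fu) = 0.
Proof.
move=> Mu; case: n u / Mu Fu => [x Xx|m n u v Mu Mv|n u Mu] Fu.
- exact: gX.
- have F p w : monomial_value X p w -> filtration X p w.
    by move=> Mw; apply: lin_span_gen; exists p.
  by rewrite (symbol_eq _ (filtrationM (F _ _ Mu) (F _ _ Mv))) // symbolM gM.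
- have F : filtration X n u by apply: lin_span_gen; exists n.
  by rewrite (symbol_eq _ (filtration_op F)) // symbolR gR.
Qed.

Lemma linear_eq0_symbol n u (Fu : filtration X n u) : g (symbol Fu) = 0.
Proof.
(* The membership proof has to be built along with the linear combination, hence the existential. *)
suff [F gF] : exists F : filtration X n u, g (symbol F) = 0.
  by rewrite (symbol_eq Fu F).
case: Fu => p [c [x [Sx ->]]].
apply: (big_ind (fun w => exists F : filtration X n w, g (symbol F) = 0)).
- by exists (lin_span0 _); rewrite symbol0 linear0.
- move=> v w [Fv gv] [Fw gw]; exists (lin_spanD Fv Fw).
  by rewrite symbolD linearD gv gw addr0.
- move=> i _; have [m lemn Mx] := Sx i.
  have Fm : filtration X m (x i) by apply: lin_span_gen; exists m.
  have Fx := filtration_le lemn Fm.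
  exists (lin_spanZ (c i) Fx); rewrite symbolZ linearZ /=.
  move: lemn; rewrite leq_eqVlt => /orP[/eqP emn|ltmn].
    by subst m; rewrite linear_eq0_monomial // scaler0.
  by rewrite (symbol_low Fx ltmn) // linear0 scaler0.
Qed.

Lemma gr_linear_eq0 p : g p = 0.
Proof.
elim/rbquotW: p => f; have [N fN] := fs_fin f.
elim: N => [|N IHN] in f fN *.
  suff -> : rbpi f = 0 by rewrite linear0.
  rewrite -(rbpi0 (RBSetoid (gr_congruence X))).
  by apply: gr_pi_eq => i; rewrite fN.
(* Subtracting the symbol of the N-th term, which [g] kills, lowers the support bound. *)
rewrite -[LHS]subr0 -{1}(linear_eq0_symbol (fs_in f N)) -linearB.
rewrite -rbpiN -rbpiD; apply: IHN => i leNi /=.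
case: eqP => [->|/eqP neNi]; first by rewrite subrr.
by rewrite subr0 fN // ltn_neqAle eq_sym neNi.
Qed.

End Generation.
End Symbol.

(* The pair (s, t) stands for s x + t x^2 in N when the type is used as a
   Rota-Baxter algebra, and for s a + t b in A when it is used as a
   precommutative algebra: both have the same product. *)
Definition trunc (k : fieldType) : Type := (k^o * k^o)%type.

Section Trunc.
Variable k : fieldType.
HB.instance Definition _ := GRing.Lmodule.on (trunc k).
Implicit Types x y z : trunc k.

Definition trunc_mul x y : trunc k := (0, x.1 * y.1).

Fact trunc_linear_r x : linear (trunc_mul x).
Proof.
move=> c y z; congr pair; first by rewrite /= addr0 [RHS]mulr0.
by rewrite /= mulrDr [X in X + _]mulrCA.
Qed.

Fact trunc_mulC : commutative trunc_mul.
Proof. by move=> x y; rewrite /trunc_mul mulrC. Qed.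

Fact trunc_linear_l y : linear (trunc_mul^~ y).
Proof. by move=> c x z; rewrite !(trunc_mulC _ y) trunc_linear_r. Qed.

Fact trunc_mulA : associative trunc_mul.
Proof. by move=> x y z; rewrite /trunc_mul /= mulr0 mul0r. Qed.

Fact trunc_zinbiel x y z :
  trunc_mul (trunc_mul x y + trunc_mul y x) z = trunc_mul x (trunc_mul y z).
Proof. by rewrite /trunc_mul /= addr0 mul0r mulr0. Qed.

HB.instance Definition _ := Lmodule_isPreCom.Build k (trunc k)
  trunc_linear_l trunc_linear_r trunc_zinbiel.

Definition trunc_op (_ : trunc k) : trunc k := 0.

Fact trunc_op_linear : linear trunc_op.
Proof. by move=> c x y; rewrite /trunc_op scaler0 addr0. Qed.

Fact trunc_rota_baxter x y :
  trunc_mul (trunc_op x) (trunc_op y) =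
  trunc_op (trunc_mul (trunc_op x) y + trunc_mul x (trunc_op y)).
Proof. by rewrite /trunc_mul mul0r. Qed.

HB.instance Definition _ := Lmodule_isRBCom.Build k (trunc k)
  trunc_linear_r trunc_mulC trunc_mulA trunc_op_linear trunc_rota_baxter.

End Trunc.

Lemma rbmul_truncE (k : fieldType) (x y : trunc k) :
  rbmul x y = (0, x.1 * y.1) :> trunc k.
Proof. by []. Qed.

Lemma zmul_truncE (k : fieldType) (x y : trunc k) :
  zmul x y = (0, x.1 * y.1) :> trunc k.
Proof. by []. Qed.

Lemma rbop_truncE (k : fieldType) (x : trunc k) : rbop x = 0 :> trunc k.
Proof. by []. Qed.

(** As R = 0 on N, the product x ≻ y = R(x) y vanishes there. *)
Lemma Ab_trunc_hom (k : fieldType) (A : preComType k)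
    (f : {linear Ab A -> psi (trunc k)}) : precom_hom f.
Proof. by move=> x y; rewrite psi_mulE rbop_truncE rbmul0l linear0. Qed.

Lemma swap_is_linear (k : fieldType) :
  linear (fun x : Ab (trunc k) => (x.2, x.1) : psi (trunc k)).
Proof. by []. Qed.

Lemma unit_trunc_sq (k : fieldType) (B : rbComType k)
    (f : {linear trunc k -> psi B}) : precom_hom f ->
  rbmul (f (0, 1) : B) (f (0, 1)) = 0.
Proof.
move=> fM.
have e1 : (0, 1) = zmul ((1, 0) : trunc k) ((1, 0) : trunc k).
  by rewrite zmul_truncE mulr1.
have e2 : zmul ((1, 0) : trunc k) ((0, 1) : trunc k) = 0.
  by rewrite zmul_truncE mulr0.
rewrite {1}e1 fM psi_mulE -rbmulA (rbmulC (f (1, 0))) rbmulA.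
by rewrite -psi_mulE -fM e2 linear0 rbmul0l.
Qed.

(** * Proportionality of x-coordinates *)

Section Coordinates.
Variables (k : fieldType) (B : rbComType k).
Variables (i : {linear trunc k -> psi B}) (iM : precom_hom i).
Notation X := (range (i : trunc k -> B)).

Lemma filtration_range x : filtration X 1 (i x).
Proof. by apply: lin_span_gen; exists 1%N => //; apply: MonVar; exists x. Qed.

Notation gr_inj x := (symbol (filtration_range x)).

Lemma gr_injE x :
  gr_inj x = (x.1 : k) *: gr_inj (1, 0) + (x.2 : k) *: gr_inj (0, 1).
Proof.
rewrite -!symbolZ -symbolD; apply: symbol_eq; rewrite -!linearZ -linearD.
congr (i _); case: x => s t; congr pair => /=.
  by rewrite scaler0 addr0 [RHS]mulr1.
by rewrite scaler0 add0r [RHS]mulr1.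
Qed.

Lemma rb_hom_coord_unit2 (h : {linear gr X -> trunc k}) :
  rb_hom h -> (h (gr_inj (0, 1))).1 = 0.
Proof.
move=> [hM _]; apply/eqP; rewrite -sqrf_eq0 expr2.
have := hM (gr_inj (0, 1)) (gr_inj (0, 1)).
rewrite -symbolM (symbol_eq _ (lin_span0 _)) ?(unit_trunc_sq iM) //.
(* The square of s x + t x^2 is s^2 x^2. *)
by rewrite symbol0 linear0 rbmul_truncE => /(congr1 snd) /= <-.
Qed.

Section Proportional.
Variables h1 h2 : {linear gr X -> trunc k}.
Hypotheses (H1 : rb_hom h1) (H2 : rb_hom h2).
Let det p q := (h1 p).1 * (h2 q).1 - (h1 q).1 * (h2 p).1.

(** For fixed q the determinant is linear in p and kills products, values of R and the class of b,
    so by generation only the class of a matters. *)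
Lemma rb_hom_coord_det q : det (gr_inj (1, 0)) q = 0 -> forall p, det p q = 0.
Proof.
move=> a0; have g_linear : linear (det^~ q : gr X -> k^o).
  have E (c s s' t t' v w : k) : (c * s + s') * v - w * (c * t + t') =
      c * (s * v - w * t) + (s' * v - w * t').
    by rewrite mulrBr mulrDl mulrDr !mulrA (mulrC c w) opprD addrACA.
  by move=> c x y; rewrite /det (linearP h1) (linearP h2); exact: E.
pose g : {linear gr X -> k^o} :=
  HB.pack (det^~ q) (GRing.isLinear.Build k (gr X) k^o *:%R _ g_linear).
apply: (gr_linear_eq0 (g := g)) => [u F [x _ xu]|p r|p].
- rewrite (symbol_eq F (filtration_range x) (esym xu)) gr_injE.
  rewrite linearD !linearZ /= a0 /det.
  rewrite (rb_hom_coord_unit2 H1) (rb_hom_coord_unit2 H2).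
  by rewrite mul0r mulr0 subrr !scaler0 addr0.
- by rewrite /= /det H1.1 H2.1 mulr0 mul0r subrr.
- by rewrite /= /det H1.2 H2.2 mulr0 mul0r subrr.
Qed.

Lemma rb_hom_coord_prop p q : (h1 p).1 * (h2 q).1 = (h1 q).1 * (h2 p).1.
Proof.
(* First p, then by antisymmetry q, is replaced by the class of a. *)
apply/eqP; rewrite -subr_eq0; apply/eqP; apply: rb_hom_coord_det.
rewrite /det -opprB; apply/eqP; rewrite oppr_eq0; apply/eqP.
by apply: rb_hom_coord_det; rewrite /det subrr.
Qed.

End Proportional.
End Coordinates.

Lemma rb_hom_comp (k : fieldType) (B C D : rbComType k)
    (g : {linear C -> D}) (f : {linear B -> C}) :
  rb_hom g -> rb_hom f -> rb_hom (g \o f : {linear B -> D}).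
Proof.
by move=> [gM gR] [fM fR]; split=> [x y|x] /=; rewrite ?fM ?gM ?fR ?gR.
Qed.

Theorem corollary1 (k : fieldType) (U : left_adjoint_of_psi k) : ~ PBW_pair U.
Proof.
move=> /(_ (trunc k)) [f [fH [f' _ f'K]]].
(* The x-coordinates of [l1] and [l2] are the two coordinate functions on A. *)
pose l1 : {linear Ab (trunc k) -> psi (trunc k)} := idfun.
pose l2 : {linear Ab (trunc k) -> psi (trunc k)} := HB.pack
  (fun x : Ab (trunc k) => (x.2, x.1) : psi (trunc k))
  (GRing.isLinear.Build k (Ab (trunc k)) (psi (trunc k)) *:%R _
     (@swap_is_linear k)).
have [g1 [g1H g1E _]] := env_universal U (Ab_trunc_hom l1).
have [g2 [g2H g2E _]] := env_universal U (Ab_trunc_hom l2).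
(* At the preimages of a and b the proportionality reads 1 * 1 = 0 * 0. *)
have := rb_hom_coord_prop (@env_unit_hom k U (trunc k))
  (rb_hom_comp g1H fH) (rb_hom_comp g2H fH)
  (f' (env_unit U (Ab (trunc k)) (1, 0)))
  (f' (env_unit U (Ab (trunc k)) (0, 1))).
rewrite /= !f'K !g1E !g2E /= mulr1 mulr0 => /eqP.
by rewrite oner_eq0.
Qed.
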